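(* Let $S_{r,N}$ be an atomic exponential Puiseux semiring. The following are equivalent: (1) $r\ge1$; (2) $S_{r,N}$ satisfies the ascending chain condition on principal ideals; (3) $S_{r,N}$ is ACCP-presentable; (4) $\omega(a)<\infty$ for every atom $a$ of $S_{r,N}$.
   Context: $\mathbb{N}=\{0,1,2,\dots\}$. A numerical monoid $N$ is an additive submonoid of $\mathbb{N}$ with finite complement. For $r\in\mathbb{Q}_{>0}$ write $r=\mathsf{n}(r)/\mathsf{d}(r)$ in lowest terms. The exponential Puiseux semiring $S_{r,N}$ is the additive submonoid of $\mathbb{Q}_{\ge0}$ generated by $\{r^k:k\in N\}$ (equal to $\mathbb{N}$ if $r\in\mathbb{N}$; for $r\notin\mathbb{N}$ atomic iff $\mathsf{n}(r)>1$). A monoid satisfies ACCP if every ascending chain of principal ideals $x+M$ stabilizes. For an atomic monoid $M$: $\mathsf{Z}(M)$ is the free commutative monoid on the atoms, $\pi:\mathsf{Z}(M)\to M$ the evaluation map, and $\sim_M=\{(z,z'):\pi(z)=\pi(z')\}$. A presentation of $M$ is a subset $\sigma\subseteq\mathsf{Z}(M)\times\mathsf{Z}(M)$ such that the smallest congruence on $\mathsf{Z}(M)$ containing $\sigma$ equals $\sim_M$. Two factorizations of the same element are $\mathcal{R}$-related if joined by a chain of factorizations of that element in which consecutive ones share an atom. For a binary relation $\sigma$ on $\mathsf{Z}(M)$, $G_\sigma$ is the graph whose vertices are the $\mathcal{R}$-classes and with an edge between distinct classes $R,R'$ when $(z,z')\in\sigma\cup\sigma^{-1}$ for some $z\in R$,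 $z'\in R'$. $M$ is ACCP-presentable if a subset $\sigma'\subseteq\sim_M$ is a presentation of $M$ if and only if for every $x\in M$ all $\mathcal{R}$-classes of $\pi^{-1}(x)$ lie in one connected component of $G_{\sigma'}$. For nonzero $x\in M$, $\omega(x)$ is the smallest $n\in\mathbb{N}\cup\{\infty\}$ such that whenever $x$ divides $a_1+\cdots+a_m$ (atoms $a_i$), $x$ divides a sub-sum of at most $n$ of the $a_i$. *)

(* Defs.v *)
From HB Require Import structures.
From mathcomp Require Import all_boot all_order all_algebra.
From mathcomp Require Import finmap.
Set Implicit Arguments. Unset Strict Implicit. Unset Printing Implicit Defensive.
Import Order.TTheory GRing.Theory Num.Theory.
Local Open Scope ring_scope.


Definition numerical_monoid (N : pred nat) : Prop :=
  [/\ N 0%N, (forall m n, N m -> N n -> N (m + n)%N)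
    & exists b : nat, forall n, (b <= n)%N -> N n].

Definition expPuiseux (r : rat) (N : pred nat) (x : rat) : Prop :=
  exists s : seq nat, all N s /\ x = \sum_(k <- s) r ^+ k.

(** Notions for a submonoid M (given as a predicate) of (Q_{>=0}, +).
    Its only unit is 0. *)
Section MonoidNotions.
Variable M : rat -> Prop.

Definition mdvd (x y : rat) : Prop := M x /\ M y /\ M (y - x).

Definition atom (a : rat) : Prop :=
  [/\ M a, a != 0 & forall b c, M b -> M c -> a = b + c -> b = 0 \/ c = 0].

Definition atomic : Prop :=
  forall x, M x -> x != 0 ->
    exists s : seq rat, (forall a, a \in s -> atom a) /\ x = \sum_(a <- s) a.

(* ACCP: every ascending chain of principal ideals x_0 + M ⊆ x_1 + M ⊆ ...
   stabilizes; x_n + M ⊆ x_{n+1} + M  iff  x_{n+1} | x_n. *)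
Definition ACCP : Prop :=
  forall x : nat -> rat, (forall n, M (x n)) ->
    (forall n, mdvd (x n.+1) (x n)) ->
    exists n0, forall n, (n0 <= n)%N -> mdvd (x n) (x n.+1).

(** Factorizations: the free commutative monoid Z(M) on the atoms,
    represented by finitely supported maps atoms -> nat. *)
Definition fz := {fsfun rat -> nat for fun _ => 0%N}.

Definition isFact (z : fz) : Prop := forall a, a \in finsupp z -> atom a.

Definition fz_add (z w : fz) : fz :=
  [fsfun a : (finsupp z `|` finsupp w)%fset => (z (val a) + w (val a))%N | 0%N].

Definition fpi (z : fz) : rat := \sum_(a <- finsupp z) (z a)%:R * a.

Definition kerM (z z' : fz) : Prop := [/\ isFact z, isFact z' & fpi z = fpi z'].

Inductive cong_gen (sigma : fz -> fz -> Prop) : fz -> fz -> Prop :=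
| cg_base z z' : sigma z z' -> cong_gen sigma z z'
| cg_refl z : isFact z -> cong_gen sigma z z
| cg_sym z z' : cong_gen sigma z z' -> cong_gen sigma z' z
| cg_trans z1 z2 z3 : cong_gen sigma z1 z2 -> cong_gen sigma z2 z3 ->
    cong_gen sigma z1 z3
| cg_add z z' w : isFact w -> cong_gen sigma z z' ->
    cong_gen sigma (fz_add z w) (fz_add z' w).

Definition presentation (sigma : fz -> fz -> Prop) : Prop :=
  (forall z z', sigma z z' -> isFact z /\ isFact z') /\
  (forall z z', cong_gen sigma z z' <-> kerM z z').

Definition share_atom (z z' : fz) : Prop := exists a, (0 < z a)%N /\ (0 < z' a)%N.

Inductive Rchain : fz -> fz -> Prop :=
| rc_refl z : isFact z -> Rchain z z
| rc_step z1 z2 z3 : kerM z1 z2 -> share_atom z1 z2 -> Rchain z2 z3 ->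
    Rchain z1 z3.

(* Connectedness in G_sigma: the R-classes of z and z' are joined by a
   path in G_sigma, i.e. there is a chain of factorizations where each step
   either stays in one R-class or crosses an edge given by a pair in
   sigma ∪ sigma^{-1}. *)
Inductive Gconn (sigma : fz -> fz -> Prop) : fz -> fz -> Prop :=
| gc_class z z' : Rchain z z' -> Gconn sigma z z'
| gc_edge z z' : sigma z z' \/ sigma z' z -> Gconn sigma z z'
| gc_trans z1 z2 z3 : Gconn sigma z1 z2 -> Gconn sigma z2 z3 ->
    Gconn sigma z1 z3.

Definition ACCP_presentable : Prop :=
  forall sigma : fz -> fz -> Prop, (forall z z', sigma z z' -> kerM z z') ->
    (presentation sigma <->
     forall x, M x -> forall z z', isFact z -> isFact z' ->
       fpi z = x -> fpi z' = x -> Gconn sigma z z').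

Definition omega_finite (x : rat) : Prop :=
  exists n : nat, forall s : seq rat, (forall a, a \in s -> atom a) ->
    mdvd x (\sum_(a <- s) a) ->
    exists t : seq rat, [/\ subseq t s, (size t <= n)%N & mdvd x (\sum_(a <- t) a)].

End MonoidNotions.

(* Main.v *)
Require Import Defs.
From mathcomp Require Import all_boot all_order all_algebra.
From mathcomp Require Import finmap zify ring lra.
From Stdlib Require Import Classical_Prop.
Import Order.TTheory GRing.Theory Num.Theory.
Local Open Scope ring_scope.

(** Write [r = n / d] in lowest terms.

    If [r >= 1], all nonzero elements are at least [1], so descending chains of
    divisors stop and relations can be generated by induction on the value. For
    the omega invariant of [r ^+ k], compare a sum [u] of atoms with
    [r ^+ k + e], where [e] uses each large power fewer than [d] times and is
    disjoint from [u]. Reading the equality from the highest power down, with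
    carries [d * r ^+ j.+1 = n * r ^+ j], the carry grows with the number of
    terms of [u] already read, and a large carry is itself divisible by
    [r ^+ k].

    If [r < 1], atomicity forces [n > 1] and makes every generator an atom.
    - ACCP fails along [n * r ^+ k], as
      [n * r ^+ k = (d - n) * r ^+ k.+1 + n * r ^+ k.+1].
    - Relate two factorizations of the same element when they have the same
      number of atoms below [r ^+ B] modulo [n]. This congruence is proper, as
      it omits [n * r ^+ B = d * r ^+ B.+1]. Yet of two disjoint factorizations,
      the one with the smallest atom, if below [r ^+ B], uses it at least [d]
      times, and replacing [n] copies by [d] copies of the next atom, repeatedly,
      stays in the R-class and reaches every residue modulo [n].
    - With [b] the least positive element of [N], a sum of atoms different from
      [1] and divisible by [1] is at least [n ^ b], and [n ^ b] is itself an
      arbitrarily long sum of powers of [r ^+ b], so [1] has infinite omega. *)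

(** * The additive monoid *)

Lemma expPuiseux0 (r : rat) N : expPuiseux r N 0.
Proof. by exists [::]; rewrite big_nil. Qed.

Lemma expPuiseuxD (r : rat) N x y :
  expPuiseux r N x -> expPuiseux r N y -> expPuiseux r N (x + y).
Proof.
by move=> [s [Ns ->]] [t [Nt ->]]; exists (s ++ t); rewrite all_cat Ns Nt big_cat.
Qed.

Lemma expPuiseuxX (r : rat) (N : pred nat) k : N k -> expPuiseux r N (r ^+ k).
Proof. by move=> Nk; exists [:: k]; rewrite /= Nk big_seq1. Qed.

Lemma expPuiseuxMn (r : rat) N x m : expPuiseux r N x -> expPuiseux r N (x *+ m).
Proof.
move=> Mx; elim: m => [|m IHm]; first exact: expPuiseux0.
by rewrite mulrS; apply: expPuiseuxD.
Qed.

Lemma expPuiseux_ge0 (r : rat) N x : 0 < r -> expPuiseux r N x -> 0 <= x.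
Proof.
by move=> r_gt0 [s [_ ->]]; apply: sumr_ge0 => k _; rewrite exprn_ge0 // ltW.
Qed.

Lemma expPuiseux_ge1 (r : rat) N x :
  1 <= r -> expPuiseux r N x -> x != 0 -> 1 <= x.
Proof.
move=> r_ge1 [[|k s] [_ ->]]; first by rewrite big_nil eqxx.
rewrite big_cons => _; apply: le_trans (exprn_ege1 k r_ge1) _.
rewrite lerDl; apply: sumr_ge0 => i _; rewrite exprn_ge0 //; lra.
Qed.

(** A nonempty sum of powers is its first power, which is nonzero, plus the rest; irreducibility
    makes the rest vanish. *)
Lemma atom_expPuiseux (r : rat) N a :
  0 < r -> atom (expPuiseux r N) a -> exists2 k, N k & a = r ^+ k.
Proof.
move=> r_gt0 [[[|k s] [/= Ns ->]]]; first by rewrite big_nil eqxx.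
case/andP: Ns => Nk Ns _; rewrite big_cons => irr; exists k => //.
have Ms : expPuiseux r N (\sum_(j <- s) r ^+ j) by exists s.
have [/eqP|->] := irr _ _ (expPuiseuxX r N k Nk) Ms erefl; last by rewrite addr0.
by rewrite expf_eq0 (gt_eqF r_gt0) andbF.
Qed.

Lemma rat_ratio (r : rat) : 0 < r ->
  exists n d : nat, [/\ (0 < n)%N, (0 < d)%N, coprime n d & n%:R = r * d%:R].
Proof.
move=> r_gt0; exists `|numq r|%N, `|denq r|%N; split.
- by rewrite absz_gt0 numq_eq0 gt_eqF.
- by rewrite absz_gt0 denq_eq0.
- exact: coprime_num_den.
rewrite !natr_absz ger0_norm ?numq_ge0 ?ltW // gtr0_norm ?denq_gt0 //.
by rewrite numqE.
Qed.

(** The basic trade of [n] copies of a power for [d] copies of the next one, iterated [m] times. *)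
Lemma expr_swap {r : rat} {n d : nat} (i m : nat) :
  n%:R = r * d%:R -> r ^+ (i + m) *+ (d ^ m) = r ^+ i *+ (n ^ m).
Proof.
move=> nd; rewrite -[LHS]mulr_natr -[RHS]mulr_natr !natrX nd exprMn exprD; ring.
Qed.

(** Multiplied by [d ^ m], the power of exponent [i] becomes [n ^ i * d ^ (m - i)]. Identities
    between elements thus become divisibility statements. *)
Lemma sum_expr_num (r : rat) (n d b m : nat) (u : seq nat) :
  n%:R = r * d%:R -> all (fun i => b <= i <= m)%N u ->
  exists A : nat, d%:R ^+ m * (\sum_(i <- u) r ^+ i) = (n ^ b * A)%:R.
Proof.
move=> nd; elim: u => [_|i u IHu /= /andP[/andP[bi im] /IHu[A IH]]].
  by exists 0%N; rewrite big_nil mulr0 muln0.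
exists (n ^ (i - b) * d ^ (m - i) + A)%N.
rewrite big_cons mulrDr IH mulnDr natrD; congr (_ + _).
rewrite mulnA -expnD subnKC // natrM !natrX nd exprMn.
rewrite -[in LHS](subnKC im) exprD; ring.
Qed.

(** * The ascending chain condition *)

Lemma ACCP_expPuiseux (r : rat) N : 1 <= r -> ACCP (expPuiseux r N).
Proof.
move=> r_ge1 x Mx dx; have r_gt0 : 0 < r by lra.
(* Induction on an integer bound for [x i]: each strict drop along the chain costs at least 1. *)
suff H m : forall i, x i < m%:R ->
    exists n0, forall n, (n0 <= n)%N -> x n.+1 = x n.
  have [n0 Hn0] := H (Num.truncn (x 0%N)).+1 0%N (truncnS_gt _).
  exists n0 => n /Hn0 e; split=> //; split=> //.
  by rewrite e subrr; apply: expPuiseux0.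
elim: m => [i|m IHm i xi].
  by have := expPuiseux_ge0 _ _ _ r_gt0 (Mx i) => ? ?; lra.
have [[j [ij xj]]|nex] := classic (exists j, (i <= j)%N /\ x j.+1 <> x j).
  apply: (IHm j.+1).
  have [_ [_ Md]] := dx j.
  have : 1 <= x j - x j.+1.
    by apply: expPuiseux_ge1 Md _ => //; rewrite subr_eq0; apply/eqP => e; apply: xj.
  have : x j <= x i.
    elim: j ij {xj Md} => [|j IHj]; first by rewrite leqn0 => /eqP ->.
    rewrite leq_eqVlt => /predU1P[->//|/IHj]; apply: le_trans.
    by have [_ [_ /(expPuiseux_ge0 _ _ _ r_gt0)]] := dx j; rewrite subr_ge0.
  by move: xi; rewrite -natr1; lra.
by exists i => n i_n; apply: NNPP => xn; apply: nex; exists n.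
Qed.

Lemma expPuiseux_refine (r : rat) (N : pred nat) n d j :
  (n <= d)%N -> n%:R = r * d%:R -> N j.+1 -> expPuiseux r N (r ^+ j *+ n - r ^+ j.+1 *+ n).
Proof.
move=> le_nd nd Nj; have := expr_swap j 1 nd; rewrite !expn1 addn1 => <-.
by rewrite -mulrnBr //; apply/expPuiseuxMn/expPuiseuxX.
Qed.

Lemma lt_ratio {r : rat} {n d : nat} : n%:R = r * d%:R -> (0 < d)%N ->
  (n < d)%N = (r < 1).
Proof.
by move=> nd d0; rewrite -(ltr_nat rat) nd -ltr_pdivlMr ?ltr0n // divff // pnatr_eq0 -lt0n.
Qed.

Lemma ACCP_ge1 (r : rat) N :
  0 < r -> numerical_monoid N -> ACCP (expPuiseux r N) -> 1 <= r.
Proof.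
move=> r_gt0 [_ _ [B NB]] accp; case: leP => // r_lt1.
have [n [d [n_gt0 d_gt0 _ nd]]] := rat_ratio _ r_gt0.
have lt_nd : (n < d)%N by rewrite (lt_ratio nd).
pose x i := r ^+ (B + i) *+ n.
have Mx i : expPuiseux r N (x i).
  by apply/expPuiseuxMn/expPuiseuxX/NB/leq_addr.
have [i|n0 /(_ n0 (leqnn _))[_ [_]]] := accp x Mx.
  split=> //; split=> //; rewrite /x addnS.
  by apply: expPuiseux_refine nd _; rewrite 1?ltnW // NB // leqW ?leq_addr.
(* Stabilization would put the negative number [x n0.+1 - x n0] into the monoid. *)
move/(expPuiseux_ge0 _ _ _ r_gt0); rewrite /x -mulrnBl pmulrn_lge0 // addnS.
by rewrite exprS -[X in _ - X]mul1r -mulrBl pmulr_lge0 ?exprn_gt0 // subr_ge0 leNgt r_lt1.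
Qed.

(** * Atoms when [r < 1] *)

Lemma atomic_num_gt1 (r : rat) N n d : 0 < r < 1 -> numerical_monoid N ->
  atomic (expPuiseux r N) -> (0 < n)%N -> (0 < d)%N -> n%:R = r * d%:R ->
  (1 < n)%N.
Proof.
move=> /andP[r_gt0 r_lt1] [N0 ND [B NB]] atm n_gt0 d_gt0 nd.
rewrite ltn_neqAle n_gt0 andbT; apply/eqP => n1; subst n.
have lt_1d : (1 < d)%N by rewrite (lt_ratio nd).
have [] := atm 1; rewrite ?oner_neq0 //; first exact: (expPuiseuxX r N 0).
case=> [[_ /eqP]|a s [/(_ a (mem_head _ _)) ata _]].
  by rewrite big_nil oner_eq0.
have [k Nk e] := atom_expPuiseux r N a r_gt0 ata; subst a.
case: ata => _ _ irr.
(* With [n = 1], [r ^+ k] equals [d ^ B.+1 > 1] copies of [r ^+ (k + B.+1)], so it is not an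
   atom. *)
have NkB : N (k + B.+1)%N by apply: ND => //; apply: NB.
have dB : (1 < d ^ B.+1)%N by rewrite (@ltn_exp2l d 0).
have := irr (r ^+ (k + B.+1)) (r ^+ (k + B.+1) *+ (d ^ B.+1).-1).
case.
- exact: expPuiseuxX.
- exact/expPuiseuxMn/expPuiseuxX.
- by rewrite -mulrS prednK ?(ltnW dB) // (expr_swap k B.+1 nd) exp1n.
- by move/eqP; rewrite expf_eq0 (gt_eqF r_gt0) andbF.
- move/eqP; rewrite mulrn_eq0 expf_eq0 (gt_eqF r_gt0) andbF orbF.
  by move: dB; case: (d ^ B.+1)%N => [|[]].
Qed.

Lemma coprime_dvd_expr (n m b k c A : nat) : coprime n m ->
  (m ^ k * c = n ^ b * A)%N -> (n ^ b %| c)%N.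
Proof.
move=> cop e; have : (n ^ b %| m ^ k * c)%N by rewrite e dvdn_mulr.
by rewrite Gauss_dvdr // coprimeXl // coprimeXr.
Qed.

(** Proper summands of [r ^+ k] are smaller, so they involve only exponents above [k]. After
    clearing denominators, [n ^ k.+1] would divide [d ^ (m - k) * n ^ k], against coprimality and
    [n > 1]. *)
Lemma expPuiseux_atom (r : rat) (N : pred nat) n d k : 0 < r < 1 -> (1 < n)%N ->
  (0 < d)%N -> coprime n d -> n%:R = r * d%:R -> N k ->
  atom (expPuiseux r N) (r ^+ k).
Proof.
move=> /andP[r_gt0 r_lt1] n_gt1 d_gt0 cop nd Nk.
split; first exact: expPuiseuxX.
  by rewrite expf_neq0 // gt_eqF.
move=> b c Mb Mc e; have [->|b0] := eqVneq b 0; first by left.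
have [->|c0] := eqVneq c 0; first by right.
have b_gt0 : 0 < b by rewrite lt_def b0 (expPuiseux_ge0 _ _ _ r_gt0 Mb).
have c_gt0 : 0 < c by rewrite lt_def c0 (expPuiseux_ge0 _ _ _ r_gt0 Mc).
have idx x : x < r ^+ k -> expPuiseux r N x -> exists2 u,
    all (fun i => k < i)%N u & x = \sum_(i <- u) r ^+ i.
  move=> xk [u [_ ex]]; exists u => //; apply/allP => i iu.
  rewrite ltnNge; apply: contraTN xk => ik; rewrite -leNgt ex (big_rem i iu) /=.
  apply: (@le_trans _ _ (r ^+ i)); first by rewrite ler_wiXn2l // ltW.
  by rewrite lerDl; apply: sumr_ge0 => j _; rewrite exprn_ge0 // ltW.
have [u ku eb] := idx b ltac:(lra) Mb; have [v kv ec] := idx c ltac:(lra) Mc.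
pose m := (k + \sum_(i <- u ++ v) i)%N.
have [|A] := sum_expr_num r n d k.+1 m (u ++ v) nd.
  apply/allP => i iuv; apply/andP; split.
    by apply: (allP _ i iuv); rewrite all_cat ku kv.
  by rewrite /m (big_rem i iuv) /= addnCA leq_addr.
rewrite big_cat /= -eb -ec -e => /eqP.
have -> : d%:R ^+ m * r ^+ k = (d ^ (m - k) * n ^ k)%:R.
  rewrite natrM !natrX nd exprMn mulrCA -exprD mulrC subnK //.
  exact: leq_addr.
rewrite eqr_nat => /eqP /(coprime_dvd_expr _ _ _ _ _ _ cop).
by rewrite dvdn_Pexp2l // ltnn.
Qed.

(** * The omega invariant *)

Lemma size_mask_sum (F : nat -> rat) (m : bitseq) (u : seq nat) :
  (forall i, 0 < F i) -> size m = size u ->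
  \sum_(i <- mask m u) F i <= \sum_(i <- u) F i /\
  (\sum_(i <- u) F i <= \sum_(i <- mask m u) F i -> size (mask m u) = size u).
Proof.
move=> F0; elim: m u => [[]//|b m IHm [//|i u] /= [/IHm[le_u eq_u]]].
have := F0 i; case: b; rewrite !big_cons => Fi; split=> [|le_u'] /=.
- by lra.
- by rewrite eq_u //; lra.
- by lra.
- by exfalso; lra.
Qed.

(** Starting from [n ^ b] copies of 1, trade [n ^ b] copies of [r ^+ (b * j)] for [d ^ b] copies of
    [r ^+ (b * j.+1)], and keep [n ^ b] of these for the next round. Each round leaves
    [d ^ b - n ^ b > 0] terms behind. *)
Lemma long_factorization (r : rat) (N : pred nat) n d b m :
  N b -> (forall i j, N i -> N j -> N (i + j)%N) ->
  (0 < b)%N -> (n < d)%N -> n%:R = r * d%:R ->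
  exists u : seq nat, [/\ all N u, all (leq b) u, (m <= size u)%N
    & \sum_(i <- u) r ^+ i = (n ^ b)%:R].
Proof.
move=> Nb ND b_gt0 lt_nd nd.
have lt_nd' : (n ^ b < d ^ b)%N by rewrite ltn_exp2r.
have N_mul j : N (b * j.+1)%N.
  by elim: j => [|j IHj]; rewrite ?muln1 // mulnS; apply: ND.
have le_mul j : (b <= b * j.+1)%N by rewrite leq_pmulr.
suff [w [Nw bw sw ew]] : exists w : seq nat,
    [/\ all N w, all (leq b) w, (m <= size w)%N & \sum_(i <- w) r ^+ i + r ^+ (b * m) *+ (n ^ b) = (n ^ b)%:R].
  exists (w ++ nseq (d ^ b)%N (b * m.+1)%N).
  rewrite !all_cat !all_nseq Nw bw N_mul le_mul !orbT size_cat.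
  split=> //; first exact: leq_trans sw (leq_addr _ _).
  by rewrite big_cat big_nseq iter_addr_0 /= -ew mulnSr -(expr_swap _ _ nd).
elim: m => [|m [w [Nw bw sw ew]]].
  by exists [::]; rewrite big_nil muln0 add0r.
exists (w ++ nseq (d ^ b - n ^ b)%N (b * m.+1)%N).
rewrite !all_cat !all_nseq Nw bw N_mul le_mul !orbT size_cat size_nseq.
split=> //; first by rewrite -addn1 leq_add // subn_gt0.
rewrite big_cat big_nseq iter_addr_0 /= -addrA -mulrnDr subnK 1?ltnW //.
by rewrite -ew mulnSr -(expr_swap _ _ nd).
Qed.

Lemma omega_finite_ge1 (r : rat) N : 0 < r -> numerical_monoid N ->
  atomic (expPuiseux r N) ->
  (forall a, atom (expPuiseux r N) a -> omega_finite (expPuiseux r N) a) ->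
  1 <= r.
Proof.
move=> r_gt0 NM atm om; case: leP => // r_lt1.
have [n [d [n_gt0 d_gt0 cop nd]]] := rat_ratio _ r_gt0.
have lt_nd : (n < d)%N by rewrite (lt_ratio nd).
have r01 : 0 < r < 1 by rewrite r_gt0.
have n_gt1 := atomic_num_gt1 _ _ _ _ r01 NM atm n_gt0 d_gt0 nd.
have at_exp k : N k -> atom (expPuiseux r N) (r ^+ k).
  exact: expPuiseux_atom nd.
case: NM => N0 ND [B NB].
have [b /andP[b_gt0 Nb] b_min] :=
  ex_minnP (ex_intro (fun b => (0 < b)%N && N b) B.+1 (NB _ (leqnSn _))).
have [K HK] := om _ (at_exp 0%N N0).
have [u [Nu bu szu eu]] := long_factorization r N n d b K.+1 Nb ND b_gt0 lt_nd nd.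
have es : \sum_(a <- [seq r ^+ i | i <- u]) a = (n ^ b)%:R by rewrite big_map.
have [||t [/subseqP[m sm et] szt [_ [_ [e [Ne ee]]]]]] := HK [seq r ^+ i | i <- u].
- by move=> a /mapP[i /(allP Nu) Ni ->]; apply: at_exp.
- rewrite es expr0; split; [exact: (expPuiseuxX r N 0)|split].
    by rewrite -eu; exists u.
  rewrite -[X in _ - X]mulr1n -natrB ?expn_gt0 ?n_gt0 // -[X in expPuiseux _ _ X]/(1 *+ _).
  exact/expPuiseuxMn/(expPuiseuxX r N 0).
move: et ee szt; rewrite -map_mask => ->; rewrite big_map size_map => ee.
rewrite size_map in sm; rewrite leqNgt => /negP[].
(* A subsum that reaches the full value [n ^ b] keeps all terms of [u], which are more than [K]. *)
suff le_sum : (n ^ b)%:R <= \sum_(i <- mask m u) r ^+ i.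
  have [|//|_ ->//] := size_mask_sum (fun i => r ^+ i) m u.
    by move=> i; rewrite exprn_gt0.
  by rewrite eu.
(* The subsum is [c.+1] plus powers whose exponents are nonzero, hence at least [b] by
   minimality. *)
pose c := count_mem 0%N e; pose e' := [seq i <- e | i != 0%N].
have {}ee : \sum_(i <- mask m u) r ^+ i = c.+1%:R + \sum_(i <- e') r ^+ i.
  rewrite -[LHS](subrK (r ^+ 0)) ee addrC -natr1 [c%:R + _]addrC -addrA; congr (_ + _).
  rewrite /c /e'; elim: (e) => [|i v IHv]; rewrite ?big_nil ?addr0 //= big_cons IHv.
  case: (eqVneq i 0%N) => [->|_] /=; first by rewrite expr0 natrD addrA.
  by rewrite big_cons addrCA.
pose H := (\sum_(i <- mask m u ++ e') i)%N.
have leH i : i \in mask m u ++ e' -> (i <= H)%N.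
  by move=> iu; rewrite /H (big_rem i iu) leq_addr.
have [|A eA] := sum_expr_num r n d b H (mask m u) nd.
  apply/allP => i iu; rewrite leH ?mem_cat ?iu // andbT.
  exact: (allP bu) (mem_mask iu).
have [|A' eA'] := sum_expr_num r n d b H e' nd.
  apply/allP => i iu; rewrite leH ?mem_cat ?iu ?orbT // andbT b_min //.
  move: iu; rewrite mem_filter => /andP[i0 /(allP Ne) ->].
  by rewrite lt0n i0.
move: eA; rewrite ee mulrDr eA' -natrX -natrM -natrD => /eqP; rewrite eqr_nat => /eqP eA.
(* All other terms are multiples of [n ^ b] once denominators are cleared, hence so is [c.+1]. *)
have dvd_c : (n ^ b %| c.+1)%N.
  apply: (coprime_dvd_expr n d b H c.+1 (A - A')) => //.
  by rewrite mulnBr -eA addnK.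
apply: (@le_trans _ _ c.+1%:R).
  by rewrite ler_nat dvdn_leq.
by rewrite lerDl; apply: sumr_ge0 => i _; rewrite exprn_ge0 // ltW.
Qed.

(** * Finite omega when [r >= 1] *)

Lemma expr_dvd_copies (r : rat) (N : pred nat) n d k B : N k ->
  (forall i, (B <= i)%N -> N i) -> (0 < d < n)%N -> n%:R = r * d%:R ->
  exists2 C : nat, (0 < C)%N & forall j c, N j -> (C <= c)%N ->
    expPuiseux r N (r ^+ j *+ c - r ^+ k).
Proof.
move=> Nk NB /andP[d_gt0 lt_dn] nd; have n_gt0 : (0 < n)%N by apply: leq_trans lt_dn.
(* One [C] serves all exponents: [n ^ k] copies suffice to trade up to [k] from below, and
   [d ^ B.+1] to trade down to [k] from exponents at most [(B + k).+1]. *)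
pose C := (n ^ k * d ^ B.+1)%N.
have C_gt0 : (0 < C)%N by rewrite muln_gt0 !expn_gt0 n_gt0 d_gt0.
suff H j : N j -> expPuiseux r N (r ^+ j *+ C - r ^+ k).
  exists C => // j c Nj leCc; rewrite -(subnK leCc) mulrnDr -addrA.
  by apply: expPuiseuxD; [exact/expPuiseuxMn/expPuiseuxX | exact: H].
have step i D p q : N i -> (0 < q)%N -> (p <= D)%N -> r ^+ i *+ p = r ^+ k *+ q ->
    expPuiseux r N (r ^+ i *+ D - r ^+ k).
  move=> Ni q_gt0 lepD e; rewrite -(subnK lepD) mulrnDr e -addrA.
  apply: expPuiseuxD; first exact/expPuiseuxMn/expPuiseuxX.
  by rewrite -(prednK q_gt0) mulrS addrAC subrr add0r; apply/expPuiseuxMn/expPuiseuxX.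
elim: j => [|j IHj] Nj.
  apply: step (n ^ k)%N (d ^ k)%N _ _ _ _ => //; first by rewrite expn_gt0 d_gt0.
    by rewrite leq_pmulr ?expn_gt0 ?d_gt0.
  by rewrite -(expr_swap 0 k nd).
case: (leqP j.+1 k) => [lejk|ltkj].
  apply: step (n ^ (k - j.+1))%N (d ^ (k - j.+1))%N _ _ _ _ => //.
  - by rewrite expn_gt0 d_gt0.
  - apply: leq_trans (_ : n ^ k <= _)%N; first by rewrite leq_pexp2l // leq_subr.
    by rewrite leq_pmulr ?expn_gt0 ?d_gt0.
  - by rewrite -(expr_swap _ _ nd) subnKC.
case: (leqP j (B + k)) => [lejB|ltBj].
  apply: step (d ^ (j.+1 - k))%N (n ^ (j.+1 - k))%N _ _ _ _ => //.
  - by rewrite expn_gt0 n_gt0.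
  - apply: leq_trans (_ : d ^ B.+1 <= _)%N; first by rewrite leq_pexp2l //; lia.
    by rewrite leq_pmull ?expn_gt0 ?n_gt0.
  - by rewrite -(expr_swap k _ nd) subnKC // ltnW.
(* For larger exponents, trading down one step turns [C] copies of [r ^+ j.+1] into more than [C]
   copies of [r ^+ j], since [n > d]. *)
have {}Nj : N j by apply: NB; lia.
have -> : r ^+ j.+1 *+ C - r ^+ k =
    r ^+ j *+ (n ^ k * d ^ B * (n - d)) + (r ^+ j *+ C - r ^+ k).
  rewrite addrA -mulrnDr; congr (_ - _).
  have := expr_swap j 1 nd; rewrite addn1 !expn1 => e.
  have -> : C = (d * (n ^ k * d ^ B))%N by rewrite /C expnS mulnCA.
  rewrite mulrnA e -mulrnA; congr (_ *+ _).
  by move: (n ^ k * d ^ B)%N => X; nia.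
by apply: expPuiseuxD; [exact/expPuiseuxMn/expPuiseuxX | exact: IHj].
Qed.

Lemma perm_nseq_count (j c : nat) (e : seq nat) : (c <= count_mem j e)%N ->
  exists f, perm_eq e (nseq c j ++ f).
Proof.
move=> lec; exists (nseq (count_mem j e - c) j ++ [seq i <- e | predC (pred1 j) i]).
rewrite catA -nseqD subnKC //; have /all_pred1P := filter_all (pred1 j) e.
by rewrite size_filter => {1}<-; rewrite perm_sym; apply/permPl/perm_filterC.
Qed.

Lemma size_le_sum_expr (r : rat) (u : seq nat) : 1 <= r ->
  (size u)%:R <= \sum_(i <- u) r ^+ i.
Proof.
move=> r_ge1; elim: u => [|i u IHu]; first by rewrite big_nil.
by rewrite big_cons /= -nat1r lerD // exprn_ege1.
Qed.

(* Trading [d] copies of [r ^+ j] for [n > d] copies of [r ^+ j.-1] lengthens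
   the sum, whose length is bounded by its value. *)
Lemma expPuiseux_normal (r : rat) (N : pred nat) n d B x : 1 <= r ->
  (forall i, (B <= i)%N -> N i) -> (0 < d < n)%N -> n%:R = r * d%:R ->
  expPuiseux r N x -> exists e, [/\ all N e, x = \sum_(i <- e) r ^+ i
    & forall j, (B < j)%N -> (count_mem j e < d)%N].
Proof.
move=> r_ge1 NB /andP[d_gt0 lt_dn] nd [e0 [Ne0 ex0]].
suff H m e : all N e -> x = \sum_(i <- e) r ^+ i -> x < (size e + m)%:R ->
    exists e, [/\ all N e, x = \sum_(i <- e) r ^+ i
    & forall j, (B < j)%N -> (count_mem j e < d)%N].
  apply: (H (Num.truncn x).+1 e0) => //; apply: lt_le_trans (truncnS_gt x) _.
  by rewrite ler_nat leq_addl.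
elim: m e => [|m IHm] e Ne ex xlt.
  by have := size_le_sum_expr r e r_ge1; rewrite -ex; move: xlt; rewrite addn0; lra.
have [/hasP[j je /andP[ltBj le_d]]|/hasPn nh] :=
  boolP (has (fun j => (B < j)%N && (d <= count_mem j e)%N) e); last first.
  exists e; split=> // j ltBj; case: (boolP (j \in e)) => [/nh|].
    by rewrite ltBj /= -ltnNge.
  by move/count_memPn ->.
have [f pf] := perm_nseq_count _ _ _ le_d.
case: j ltBj {je le_d} pf => // j; rewrite ltnS => leBj pf.
apply: (IHm (nseq n j ++ f)).
- move: Ne; rewrite (perm_all _ pf) !all_cat => /andP[_ ->].
  by rewrite all_nseq NB ?orbT.
- rewrite ex (perm_big _ pf) !big_cat /= !big_nseq !iter_addr_0.
  by have := expr_swap j 1 nd; rewrite addn1 !expn1 => ->.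
- apply: lt_le_trans xlt _; rewrite ler_nat (perm_size pf) !size_cat !size_nseq.
  by rewrite addnS -!addSn !leq_add2r.
Qed.

Lemma sum_gt_split (V : nmodType) (F : nat -> V) (J : nat) (u : seq nat) :
  \sum_(i <- u | (J < i)%N) F i =
  \sum_(i <- u | (J.+1 < i)%N) F i + F J.+1 *+ count_mem J.+1 u.
Proof.
elim: u => [|i u IHu]; first by rewrite !big_nil mulr0n addr0.
rewrite !big_cons /= IHu; case: (ltngtP i J.+1) => [lt|gt|->].
- by rewrite add0n.
- by rewrite add0n addrA.
- by rewrite mulrS addrCA.
Qed.

Lemma count_gt_split (J : nat) (u : seq nat) :
  count (fun i => J < i)%N u =
  (count (fun i => J.+1 < i)%N u + count_mem J.+1 u)%N.
Proof. elim: u => //= i u ->; case: (ltngtP i J.+1); lia. Qed.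

Lemma size_le_count_gt (P C : nat) (u : seq nat) :
  (forall j, (j <= P)%N -> (count_mem j u <= C)%N) ->
  (size u <= count (fun i => P < i) u + P.+1 * C)%N.
Proof.
elim: P => [|P IHP] le_C.
  have -> : size u = (count (fun i => 0 < i)%N u + count_mem 0%N u)%N.
    by elim: u {le_C} => //= -[|i] u ->; lia.
  by rewrite mul1n leq_add2l le_C.
have := le_C P.+1 (leqnn _).
have := IHP (fun j le_j => le_C j (leqW le_j)); rewrite count_gt_split; lia.
Qed.

Lemma subseq_nseq_count (j c : nat) (u : seq nat) : (c <= count_mem j u)%N ->
  subseq (nseq c j) u.
Proof.
move=> lec; apply: subseq_trans (filter_subseq (pred1 j) u).
have /all_pred1P := filter_all (pred1 j) u.
rewrite size_filter => ->; rewrite -(subnKC lec) nseqD; exact: prefix_subseq.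
Qed.

(** After multiplication by [d ^ J.+1], terms of exponent at most [J] become multiples of [d], while
    [r ^+ J.+1] becomes [n ^ J.+1], coprime to [d]. Hence [n * q + c] and [f] agree modulo [d], and
    [f < d] makes the quotient nonnegative. *)
Lemma carry_quotient (r : rat) (n d J k q c f : nat) (u e : seq nat) :
  coprime n d -> n%:R = r * d%:R -> (0 < d)%N -> (k <= J)%N ->
  \sum_(i <- u) r ^+ i = r ^+ k + \sum_(i <- e) r ^+ i -> (f < d)%N ->
  \sum_(i <- u | (J < i)%N) r ^+ i - \sum_(i <- e | (J < i)%N) r ^+ i =
    r ^+ J.+1 *+ (n * q + c) - r ^+ J.+1 *+ f ->
  exists q', (n * q + c = d * q' + f)%N.
Proof.
move=> cop nd d_gt0 kJ e_sum lt_fd e_tail.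
have [|A eA] := sum_expr_num r n d 0 J [seq i <- u | ~~ (J < i)%N] nd.
  by apply/allP => i; rewrite mem_filter -leqNgt => /andP[->].
have [|A' eA'] := sum_expr_num r n d 0 J (k :: [seq i <- e | ~~ (J < i)%N]) nd.
  by rewrite /= kJ; apply/allP => i; rewrite mem_filter -leqNgt => /andP[->].
rewrite big_cons in eA'; rewrite !big_filter in eA eA'.
move: e_sum; rewrite (bigID (fun i => J < i)%N) /=.
rewrite [\sum_(i <- e) _](bigID (fun i => J < i)%N) /= => e_sum.
have {}e_tail : ((n * q + c) * n ^ J.+1 + d * A = d * A' + f * n ^ J.+1)%N.
  have dJ : d%:R ^+ J.+1 * r ^+ J.+1 = (n ^ J.+1)%:R :> rat.
    by rewrite natrX nd exprMn mulrC.
  suff /eqP : (n * q + c)%:R * (n ^ J.+1)%:R + d%:R * A%:R =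
      d%:R * A'%:R + f%:R * (n ^ J.+1)%:R :> rat.
    by rewrite -!natrM -!natrD eqr_nat => /eqP.
  move: eA eA'; rewrite -dJ expn0 !mul1n => <- <-.
  move: e_tail e_sum; rewrite -[_ *+ (n * q + c)]mulr_natl -[_ *+ f]mulr_natl.
  move: (\sum_(i <- u | (J < i)%N) _) (\sum_(i <- e | (J < i)%N) _) => U E.
  move: (\sum_(i <- u | _) _) (\sum_(i <- e | _) _) => U' E'.
  set y := (n * q + c)%:R; set R := r ^+ J.+1 => e1 e2.
  have -> : r ^+ k + E' = U - E + U' by lra.
  rewrite e1 [d%:R ^+ _]exprS; ring.
have copX : coprime d (n ^ J.+1) by rewrite coprime_sym coprimeXl.
have le_f : (f <= n * q + c)%N.
  rewrite leqNgt; apply/negP => lt_f.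
  have : (d %| n ^ J.+1 * (f - (n * q + c)))%N.
    apply/dvdnP; exists (A - A')%N; nia.
  by rewrite Gauss_dvdr // gtnNdvd; lia.
have : (d %| n ^ J.+1 * (n * q + c - f))%N.
  by apply/dvdnP; exists (A' - A)%N; nia.
rewrite Gauss_dvdr // => /dvdnP[q' eq']; exists q'; lia.
Qed.

Lemma omega_bound_gt1 (r : rat) (N : pred nat) k : 1 < r ->
  numerical_monoid N -> N k ->
  exists K : nat, forall u, all N u ->
    expPuiseux r N (\sum_(i <- u) r ^+ i - r ^+ k) ->
    exists v, [/\ subseq v u, (size v <= K)%N
      & expPuiseux r N (\sum_(i <- v) r ^+ i - r ^+ k)].
Proof.
move=> r_gt1 [_ _ [B NB]] Nk; have r_gt0 : 0 < r by lra.
have r_ge1 : 1 <= r by lra.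
have [n [d [n_gt0 d_gt0 cop nd]]] := rat_ratio _ r_gt0.
have lt_dn : (d < n)%N.
  rewrite ltn_neqAle leqNgt (lt_ratio nd) // -leNgt r_ge1 andbT.
  apply/eqP => edn; move: nd; rewrite edn => nd.
  suff : r = 1 by lra.
  by apply: (@mulIf _ n%:R); rewrite ?pnatr_eq0 -?lt0n // mul1r -nd.
have d_n : (0 < d < n)%N by rewrite d_gt0.
have [C C_gt0 HC] := expr_dvd_copies r N n d k B Nk NB d_n nd.
(* Exponents from [P] on lie in [N], those above [P] occur fewer than [d] times in a normal form,
   and [k <= P]. *)
pose P := maxn B k.
(* [d * C + C] bounds the terms above the level where the carry first reaches [C]; [P.+1 * C] bounds
   those of exponent at most [P]. *)
pose K := (d * C + C + P.+1 * C)%N; exists K => u.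
have [m] := ubnP (size u); elim: m u => // m IHm u lt_um Nu Mu.
have [e [Ne ee norm_e]] := expPuiseux_normal r N n d B _ r_ge1 NB d_n nd Mu.
(* A term common to [u] and [e] cancels, and induction applies to the shorter [u]. *)
have [/hasP[j ju je]|/hasPn disj] := boolP (has (mem e) u).
  have [|||v [sv szv Mv]] := IHm (rem j u).
  - by rewrite size_rem // -ltnS prednK //; case: (u) ju.
  - by apply/allP => i /mem_rem /(allP Nu).
  - exists (rem j e); split.
      by apply/allP => i /mem_rem /(allP Ne).
    by move: ee; rewrite (big_rem j ju) (big_rem j je) /=; lra.
  by exists v; split=> //; apply: subseq_trans sv (rem_subseq _ _).
have {}disj j : count_mem j u = 0%N \/ count_mem j e = 0%N.
  have [/disj/count_memPn|/count_memPn] := boolP (j \in u); by [left|right].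
have {}ee : \sum_(i <- u) r ^+ i = r ^+ k + \sum_(i <- e) r ^+ i by lra.
set goal := exists v, _.
have copies j : (C <= count_mem j u)%N -> goal.
  move=> leC; exists (nseq C j); split; first exact: subseq_nseq_count.
    by rewrite size_nseq /K; lia.
  rewrite big_nseq iter_addr_0; apply: HC => //; apply: (allP Nu).
  by rewrite -has_pred1 has_count; apply: leq_trans leC.
pose H := (\sum_(i <- u ++ e) i)%N.
(* [r ^+ J *+ (n * q)] is the carry left by the terms of index above [J]. Since
   [n > d] and [u], [e] are disjoint, it grows with each term of [u]; once it
   reaches [C] copies, these terms alone are divisible by [r ^+ k]. *)
have carry l J : (P <= J)%N -> (H <= J + l)%N -> goal \/
    exists q, [/\ (q < C)%N, (count (fun i => J < i)%N u <= d * q)%N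
    & \sum_(i <- u | (J < i)%N) r ^+ i =
      \sum_(i <- e | (J < i)%N) r ^+ i + r ^+ J *+ (n * q)].
  have leH i : i \in u ++ e -> (i <= H)%N.
    by move=> iue; rewrite /H (big_rem i iue) leq_addr.
  (* The recursion runs downwards from [H], above which [u] and [e] have no terms and the carry is
     0. *)
  elim: l J => [|l IHl] J leP leHJ.
    have leJ i : i \in u ++ e -> (J < i)%N = false.
      by move=> /leH leiH; apply/negbTE; rewrite -leqNgt (leq_trans leiH) //;
        rewrite addn0 in leHJ.
    right; exists 0%N; rewrite !muln0 leqn0 C_gt0 mulr0n addr0; split=> //.
      rewrite -leqn0 leqNgt -has_count; apply/hasPn => i iu.
      by rewrite leJ // mem_cat iu.
    have tail0 w : {subset w <= u ++ e} -> \sum_(i <- w | (J < i)%N) r ^+ i = 0.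
      by move=> sub; rewrite big_seq_cond big1 // => i /andP[/sub/leJ ->].
    by rewrite !tail0 // => i iw; rewrite mem_cat iw ?orbT.
  have [||//|[q [lt_qC le_cnt e_tail]]] := IHl J.+1; [by lia|by lia|by left|].
  have [/copies|lt_cC] := leqP C (count_mem J.+1 u); first by left.
  have lt_fd : (count_mem J.+1 e < d)%N by apply: norm_e; lia.
  have e_u := sum_gt_split _ (fun i => r ^+ i) J u.
  have e_e := sum_gt_split _ (fun i => r ^+ i) J e.
  have [||q' eq'] := carry_quotient r n d J k q (count_mem J.+1 u) _ u e
    cop nd d_gt0 _ ee lt_fd; first by lia.
    by rewrite e_u e_e e_tail mulrnDr; ring.
  have {}e_tail : \sum_(i <- u | (J < i)%N) r ^+ i =
      \sum_(i <- e | (J < i)%N) r ^+ i + r ^+ J *+ (n * q').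
    have := expr_swap J 1 nd; rewrite addn1 !expn1 => eJ.
    rewrite e_u e_e e_tail -!addrA; congr (_ + _).
    by rewrite [in RHS]mulrnA -eJ -mulrnA -!mulrnDr eq' addnC.
  (* If [u] has no term at [J.+1], then [d * q <= n * q < d * q'.+1] gives [q <= q']. If [e] has
     none, the [c] new terms of [u] are paid for by [d * q + c <= n * q + c = d * q']. *)
  have le_cnt' : (count (fun i => J < i)%N u <= d * q')%N.
    have le_dn : (d * q <= n * q)%N by rewrite leq_mul2r ltnW ?orbT.
    rewrite count_gt_split; case: (disj J.+1) => e0; last by lia.
    rewrite e0 addn0 (leq_trans le_cnt) // leq_mul2l -ltnS -(ltn_pmul2l d_gt0).
    by rewrite mulnS; apply/orP; right; lia.
  have [leCq|ltqC] := leqP C q'; last by right; exists q'.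
  left; exists [seq i <- u | (J < i)%N]; split; first exact: filter_subseq.
    by rewrite size_filter count_gt_split /K; nia.
  rewrite big_filter e_tail -addrA; apply: expPuiseuxD.
    rewrite -big_filter; exists [seq i <- e | (J < i)%N]; split=> //.
    by apply/allP => i; rewrite mem_filter => /andP[_ /(allP Ne)].
  by apply: HC; [apply: NB; lia | nia].
have [//|||[q [lt_qC le_cnt _]]] := carry H P; rewrite ?leq_addl //.
(* The terms above [P] are now few: either some exponent up to [P] occurs [C] times, or [u] itself
   is short. *)
have [/hasP[j _ /copies//]|/hasPn small] :=
  boolP (has (fun j => C <= count_mem j u)%N (iota 0 P.+1)).
exists u; split=> //; apply: leq_trans (size_le_count_gt P C u _) _.
  by move=> j lejP; apply: ltnW; rewrite ltnNge small // mem_iota.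
by rewrite /K; nia.
Qed.

Lemma omega_finite_expPuiseux (r : rat) N a : 1 <= r -> numerical_monoid N ->
  atom (expPuiseux r N) a -> omega_finite (expPuiseux r N) a.
Proof.
move=> r_ge1 NM ata; have r_gt0 : 0 < r by lra.
have [k Nk ea] := atom_expPuiseux r N a r_gt0 ata; subst a.
have exps s : (forall a, a \in s -> atom (expPuiseux r N) a) ->
    exists2 u, all N u & s = [seq r ^+ i | i <- u].
  elim: s => [|a s IHs] ats; first by exists [::].
  have [i Ni ->] := atom_expPuiseux r N a r_gt0 (ats a (mem_head _ _)).
  have [|u Nu ->] := IHs; first by move=> b bs; apply: ats; rewrite inE bs orbT.
  by exists (i :: u); rewrite //= Ni.
have Mexp u : all N u -> expPuiseux r N (\sum_(i <- u) r ^+ i) by exists u.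
have [K HK] : exists K : nat, forall u, all N u ->
    expPuiseux r N (\sum_(i <- u) r ^+ i - r ^+ k) ->
    exists v, [/\ subseq v u, (size v <= K)%N
      & expPuiseux r N (\sum_(i <- v) r ^+ i - r ^+ k)].
  move: r_ge1; rewrite le_eqVlt => /predU1P[r1|]; last first.
    by move=> r_gt1; apply: omega_bound_gt1.
  (* For [r = 1] every power is 1, so any single term suffices. *)
  subst r; exists 1%N => -[|i u] _.
    by move/(expPuiseux_ge0 _ _ _ r_gt0); rewrite big_nil expr1n; lra.
  move=> _; exists [:: i]; split=> //; first by rewrite sub1seq mem_head.
  by rewrite big_seq1 !expr1n subrr; apply: expPuiseux0.
exists K => s /exps[u Nu ->] [_ [_]]; rewrite big_map => /(HK _ Nu)[v [sv szv Mv]].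
exists [seq r ^+ i | i <- v]; rewrite size_map big_map.
split=> //; first exact: map_subseq.
split; [exact: expPuiseuxX|split=> //; apply: Mexp].
by apply/allP => i /(mem_subseq sv) /(allP Nu).
Qed.

(** * Presentations *)

(** Additive extension of [h] to factorizations; it yields [fpi] for the identity and [count_below]
    for an indicator function. *)
Definition fz_weight (V : nmodType) (h : rat -> V) (z : fz) : V :=
  \sum_(a <- finsupp z) h a *+ z a.

Definition fz_single (a : rat) (c : nat) : fz := [fsfun x in [fset a]%fset => c | 0%N].

Definition fz_sub (z w : fz) : fz := [fsfun x in finsupp z => (z x - w x)%N | 0%N].

Lemma fz_addE z w a : fz_add z w a = (z a + w a)%N.
Proof.
rewrite (fsfun_fun _ _ _ (fun a => (z a + w a)%N)) in_fsetU.
by rewrite !mem_finsupp; case: (z a) => //; case: (w a).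
Qed.

Lemma fz_singleE a c x : fz_single a c x = if x == a then c else 0%N.
Proof. by rewrite fsfun_fun inE. Qed.

Lemma fz_subE z w x : fz_sub z w x = (z x - w x)%N.
Proof. by rewrite fsfun_fun mem_finsupp; case: (z x). Qed.

Lemma fz_subK (z w : fz) : (forall a, (w a <= z a)%N) -> fz_add (fz_sub z w) w = z.
Proof. by move=> le_wz; apply/fsfunP => a; rewrite fz_addE fz_subE subnK. Qed.

Lemma fz_weight_widen (V : nmodType) (h : rat -> V) (z : fz) (S : {fset rat}) :
  (finsupp z `<=` S)%fset -> fz_weight V h z = \sum_(a <- S) h a *+ z a.
Proof.
move=> sub; apply: big_fset_incl => // a _; rewrite memNfinsupp => /eqP ->.
by rewrite mulr0n.
Qed.

Lemma fz_weightD (V : nmodType) (h : rat -> V) z w :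
  fz_weight V h (fz_add z w) = fz_weight V h z + fz_weight V h w.
Proof.
pose S := (finsupp z `|` finsupp w)%fset.
rewrite (fz_weight_widen _ _ z S) ?fsubsetUl // (fz_weight_widen _ _ w S) ?fsubsetUr //.
rewrite (fz_weight_widen _ _ _ S).
  by rewrite -big_split; apply: eq_bigr => a _; rewrite fz_addE mulrnDr.
apply/fsubsetP => a; rewrite in_fsetU !mem_finsupp fz_addE.
by case: (z a).
Qed.

Lemma fz_weight_single (V : nmodType) (h : rat -> V) a c :
  fz_weight V h (fz_single a c) = h a *+ c.
Proof.
rewrite (fz_weight_widen _ _ _ [fset a]%fset).
  by rewrite big_seq_fset1 fz_singleE eqxx.
by apply/fsubsetP => x; rewrite mem_finsupp fz_singleE inE; case: (x == a).
Qed.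

Lemma fpiE z : fpi z = fz_weight rat id z.
Proof. by apply: eq_bigr => a _; rewrite mulr_natl. Qed.

Lemma fpiD z w : fpi (fz_add z w) = fpi z + fpi w.
Proof. by rewrite !fpiE fz_weightD. Qed.

Lemma fpi_single a c : fpi (fz_single a c) = a *+ c.
Proof. by rewrite fpiE fz_weight_single. Qed.

Lemma isFactP M (z : fz) : isFact M z <-> forall a, (0 < z a)%N -> atom M a.
Proof. by split=> Fz a; move: (Fz a); rewrite mem_finsupp lt0n. Qed.

Lemma isFactD M z w : isFact M z -> isFact M w -> isFact M (fz_add z w).
Proof.
move=> /isFactP Fz /isFactP Fw; apply/isFactP => a.
by rewrite fz_addE addn_gt0 => /orP[/Fz|/Fw].
Qed.

Lemma isFact_single M a c : atom M a -> isFact M (fz_single a c).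
Proof.
move=> ata; apply/isFactP => x.
by rewrite fz_singleE; case: eqP => [->|].
Qed.

Lemma isFact_sub M z w : isFact M z -> isFact M (fz_sub z w).
Proof.
move=> /isFactP Fz; apply/isFactP => a; rewrite fz_subE subn_gt0 => lt_wz.
by apply: Fz; apply: leq_trans lt_wz.
Qed.

(** * Congruences and connectedness *)

Lemma kerM_sym M z z' : kerM M z z' -> kerM M z' z.
Proof. by case. Qed.

Lemma kerM_trans M z1 z2 z3 : kerM M z1 z2 -> kerM M z2 z3 -> kerM M z1 z3.
Proof. by move=> [F1 _ e12] [_ F3 e23]; split; rewrite ?e12. Qed.

Lemma kerM_add M z z' w : isFact M w -> kerM M z z' ->
  kerM M (fz_add z w) (fz_add z' w).
Proof. by move=> Fw [Fz Fz' e]; split; rewrite ?fpiD ?e //; apply: isFactD. Qed.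

Lemma cong_gen_min M (sigma tau : fz -> fz -> Prop) :
  (forall z z', sigma z z' -> tau z z') ->
  (forall z, isFact M z -> tau z z) ->
  (forall z z', tau z z' -> tau z' z) ->
  (forall z1 z2 z3, tau z1 z2 -> tau z2 z3 -> tau z1 z3) ->
  (forall z z' w, isFact M w -> tau z z' -> tau (fz_add z w) (fz_add z' w)) ->
  forall z z', cong_gen M sigma z z' -> tau z z'.
Proof.
move=> base refl sym trans add z z'; elim=> {z z'}.
- exact: base.
- exact: refl.
- by move=> z z' _; apply: sym.
- by move=> z1 z2 z3 _ t12 _; apply: trans.
- by move=> z z' w Fw _; apply: add.
Qed.

Lemma cong_gen_kerM M (sigma : fz -> fz -> Prop) z z' :
  (forall z z', sigma z z' -> kerM M z z') -> cong_gen M sigma z z' -> kerM M z z'.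
Proof.
move=> sub; apply: cong_gen_min => //; [exact: kerM_sym|exact: kerM_trans|].
exact: kerM_add.
Qed.

Lemma Rchain_kerM M z z' : Rchain M z z' -> kerM M z z'.
Proof. by elim=> {z z'} // z1 z2 z3 k12 _ _; apply: kerM_trans. Qed.

Lemma Rchain_trans M z1 z2 z3 : Rchain M z1 z2 -> Rchain M z2 z3 -> Rchain M z1 z3.
Proof.
move=> c12 c23; elim: c12 c23 => {z1 z2} // z1 z2 z k12 s12 _ IH /IH.
exact: rc_step.
Qed.

Lemma Rchain1 M z z' : kerM M z z' -> share_atom z z' -> Rchain M z z'.
Proof. by move=> k s; have [_ Fz' _] := k; apply: rc_step k s (rc_refl _). Qed.

Lemma Rchain_sym M z z' : Rchain M z z' -> Rchain M z' z.
Proof.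
elim=> {z z'} [z Fz|z1 z2 z3 k12 [a [a1 a2]] _ IH]; first exact: rc_refl.
apply: Rchain_trans IH _; apply: Rchain1; first exact: kerM_sym.
by exists a.
Qed.

Lemma Gconn_sym M sigma z z' : Gconn M sigma z z' -> Gconn M sigma z' z.
Proof.
elim=> {z z'} [z z' c|z z' [s|s]|z1 z2 z3 _ c21 _ c32].
- exact/gc_class/Rchain_sym.
- by apply: gc_edge; right.
- by apply: gc_edge; left.
- exact: gc_trans c32 c21.
Qed.

Lemma Gconn_kerM M (sigma : fz -> fz -> Prop) z z' :
  (forall z z', sigma z z' -> kerM M z z') -> Gconn M sigma z z' -> kerM M z z'.
Proof.
move=> sub; elim=> {z z'} [z z' /Rchain_kerM//|z z' [/sub//|/sub/kerM_sym//]|].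
by move=> z1 z2 z3 _ k12 _; apply: kerM_trans.
Qed.

(** Only translation needs an argument: after adding a nonempty [w], both sides share an atom of
    [w], so they lie in one R-class. *)
Lemma cong_gen_Gconn M (sigma : fz -> fz -> Prop) z z' :
  (forall z z', sigma z z' -> kerM M z z') ->
  cong_gen M sigma z z' -> Gconn M sigma z z'.
Proof.
move=> sub; apply: cong_gen_min => {z z'}.
- by move=> z z' s; apply: gc_edge; left.
- by move=> z Fz; apply/gc_class/rc_refl.
- by move=> z z'; apply: Gconn_sym.
- by move=> z1 z2 z3; apply: gc_trans.
move=> z z' w Fw c; have k := kerM_add M z z' w Fw (Gconn_kerM _ _ _ _ sub c).
have [w0|[a aw]] := fset_0Vmem (finsupp w).
  have add0 y : fz_add y w = y.
    apply/fsfunP => a; rewrite fz_addE [w a]fsfun_dflt ?addn0 //.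
    by rewrite w0 inE.
  by rewrite !add0.
apply/gc_class/Rchain1 => //; exists a; move: aw.
by rewrite mem_finsupp !fz_addE -lt0n => wa; rewrite !addn_gt0 wa !orbT.
Qed.

Lemma fpi_ge0 M z : (forall a, atom M a -> 0 <= a) -> isFact M z -> 0 <= fpi z.
Proof.
move=> at_ge0 Fz; rewrite /fpi big_seq; apply: sumr_ge0 => a /Fz/at_ge0 a0.
by rewrite mulr_ge0.
Qed.

Lemma fz_split_atom (z : fz) a : (0 < z a)%N ->
  fz_add (fz_sub z (fz_single a 1)) (fz_single a 1) = z.
Proof.
by move=> za; apply: fz_subK => x; rewrite fz_singleE; case: eqP => [->|].
Qed.

(** Presentations connect by [cong_gen_Gconn]. Conversely, neighbours in an R-chain share an atom;
    cancelling it lowers the value by at least 1, so the remainders are congruent by induction. *)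
Lemma atoms_ge1_presentable (M : rat -> Prop) :
  (forall a, atom M a -> 1 <= a) -> (forall z, isFact M z -> M (fpi z)) ->
  ACCP_presentable M.
Proof.
move=> at_ge1 Mfpi sigma sub; split=> [[_ pres] x _ z z' Fz Fz' ez ez'|conn].
  by apply: cong_gen_Gconn => //; apply/pres; split; rewrite ?ez.
split=> [z z' /sub[]//|z z']; split; first exact: cong_gen_kerM.
suff H m : forall z z', fpi z < m%:R -> kerM M z z' -> cong_gen M sigma z z'.
  exact: (H (Num.truncn (fpi z)).+1 z z' (truncnS_gt _)).
elim: m => [|m IHm] {}z {}z' lt_m.
  case=> Fz _ _; have := @fpi_ge0 M z _ Fz; rewrite leNgt lt_m => H.
  by exfalso; apply: notF; apply: H => a /at_ge1; lra.
case=> Fz Fz' e; have := conn _ (Mfpi _ Fz) z z' Fz Fz' erefl (esym e).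
move=> c; elim: c lt_m {Fz Fz' e} => {z z'} [z z'|z z' [s|s]|].
- elim=> {z z'} [z Fz _|z1 z2 z3 k12 [a [a1 a2]] c23 IH lt1].
    exact: cg_refl.
  have [F1 F2 e12] := k12.
  apply: cg_trans (IH _); last by rewrite -e12.
  have ata : atom M a by move/isFactP: F1; apply.
  have f1 := fz_split_atom z1 a a1; have f2 := fz_split_atom z2 a a2.
  rewrite -f1 -f2; apply: cg_add; first exact: isFact_single.
  have e1 := fpiD (fz_sub z1 (fz_single a 1)) (fz_single a 1).
  have e2 := fpiD (fz_sub z2 (fz_single a 1)) (fz_single a 1).
  rewrite f1 fpi_single in e1; rewrite f2 fpi_single in e2.
  apply: IHm.
    by move: lt1; rewrite e1 -natr1; have := at_ge1 a ata; lra.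
  split; try exact: isFact_sub.
  by move: e12; rewrite e1 e2; apply: addIr.
- by move=> _; apply: cg_base.
- by move=> _; apply/cg_sym/cg_base.
- move=> z1 z2 z3 c12 IH12 _ IH23 lt1; apply: cg_trans (IH12 lt1) (IH23 _).
  by have [_ _ <-] := Gconn_kerM _ _ _ _ sub c12.
Qed.

Lemma fpi_expPuiseux (r : rat) N z :
  isFact (expPuiseux r N) z -> expPuiseux r N (fpi z).
Proof.
move=> Fz; rewrite /fpi big_seq; apply: big_ind.
- exact: expPuiseux0.
- by move=> x y; apply: expPuiseuxD.
- by move=> a /Fz[Ma _ _]; rewrite mulr_natl; apply: expPuiseuxMn.
Qed.

Lemma presentable_expPuiseux (r : rat) N :
  1 <= r -> ACCP_presentable (expPuiseux r N).
Proof.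
move=> r_ge1; apply: atoms_ge1_presentable => [a [Ma a0 _]|z].
  exact: expPuiseux_ge1 Ma a0.
exact: fpi_expPuiseux.
Qed.

(** * Failure of presentability when [r < 1] *)

Definition count_below (x : rat) (z : fz) : nat :=
  fz_weight nat (fun a => if a < x then 1%N else 0%N) z.

Lemma count_belowD x z w :
  count_below x (fz_add z w) = (count_below x z + count_below x w)%N.
Proof. exact: fz_weightD. Qed.

Lemma count_below_single x a c :
  count_below x (fz_single a c) = if a < x then c else 0%N.
Proof.
rewrite /count_below fz_weight_single; case: (a < x); last by rewrite mul0rn.
exact: natn.
Qed.

Lemma count_below0 x (z : fz) :
  (forall a, (0 < z a)%N -> x <= a) -> count_below x z = 0%N.
Proof.
move=> ge_x; rewrite /count_below /fz_weight big_seq big1 // => a.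
by rewrite mem_finsupp -lt0n => /ge_x; rewrite leNgt => /negbTE ->; rewrite mul0rn.
Qed.

(* Replacing [n] copies of [r ^+ L] by [d] copies of [r ^+ L.+1] keeps [d - n]
   of the former, so all the factorizations obtained this way are R-related. *)
Lemma Rchain_refine (r : rat) (N : pred nat) n d J L (z : fz) i :
  0 < r < 1 -> n%:R = r * d%:R -> (n < d)%N -> (J < L)%N ->
  (forall j, (L <= j)%N -> atom (expPuiseux r N) (r ^+ j)) ->
  isFact (expPuiseux r N) z -> (d <= z (r ^+ L))%N ->
  exists y : fz, [/\ Rchain (expPuiseux r N) z y, (d <= y (r ^+ (L + i)))%N
    & count_below (r ^+ J) y = (count_below (r ^+ J) z + i * (d - n))%N].
Proof.
move=> /andP[r_gt0 r_lt1] nd lt_nd lt_JL at_exp Fz le_dz.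
elim: i => [|i [y [c le_dy e_cnt]]].
  by exists z; rewrite addn0 mul0n addn0; split=> //; apply: rc_refl.
have [_ Fy _] := Rchain_kerM _ _ _ c.
have at1 := at_exp (L + i)%N (leq_addr _ _).
have at2 := at_exp (L + i.+1)%N (leq_addr _ _).
have below j : (L <= j)%N -> (r ^+ j < r ^+ J) = true.
  by move=> leLj; rewrite ltr_iXn2l //; apply: leq_trans leLj.
pose w := fz_sub y (fz_single (r ^+ (L + i)) n).
have ew : fz_add w (fz_single (r ^+ (L + i)) n) = y.
  apply: fz_subK => a; rewrite fz_singleE; case: eqP => [->|//].
  exact: leq_trans (ltnW lt_nd) le_dy.
exists (fz_add w (fz_single (r ^+ (L + i.+1)) d)); split.
- apply: Rchain_trans c (Rchain1 _ _ _ _ _).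
    split=> //; first by apply: isFactD; [exact: isFact_sub|exact: isFact_single].
    rewrite -[in LHS]ew !fpiD !fpi_single addnS.
    by have := expr_swap (L + i) 1 nd; rewrite !expn1 addn1 => ->.
  exists (r ^+ (L + i)); rewrite fz_addE fz_subE !fz_singleE eqxx.
  by split; lia.
- by rewrite fz_addE fz_singleE eqxx leq_addl.
- move: e_cnt; rewrite -[in X in X -> _]ew !count_belowD !count_below_single.
  rewrite !below ?leq_addr //; lia.
Qed.

(** As [r < 1], atoms at least [r ^+ m] have exponent at most [m], so [d ^ m] clears their
    denominators. *)
Lemma fpi_den (r : rat) (N : pred nat) n d m (z : fz) :
  0 < r < 1 -> n%:R = r * d%:R -> isFact (expPuiseux r N) z ->
  (forall a, (0 < z a)%N -> r ^+ m <= a) ->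
  exists A : nat, d%:R ^+ m * fpi z = A%:R.
Proof.
move=> /andP[r_gt0 r_lt1] nd Fz ge_m; rewrite /fpi big_seq.
apply: (big_ind (fun x => exists A : nat, d%:R ^+ m * x = A%:R)).
- by exists 0%N; rewrite mulr0.
- by move=> x y [A eA] [A' eA']; exists (A + A')%N; rewrite mulrDr eA eA' natrD.
move=> a az; have [k _ ea] := atom_expPuiseux r N a r_gt0 (Fz a az).
have le_km : (k <= m)%N.
  move: az (ge_m a); rewrite mem_finsupp -lt0n ea => az /(_ az).
  by rewrite ler_iXn2l.
exists (z a * (d ^ (m - k) * n ^ k))%N.
rewrite !natrM !natrX nd exprMn ea -[in LHS](subnK le_km) exprD; ring.
Qed.

(** All other atoms have exponent at most [L], so [d ^ L.+1] turns their contributions into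
    multiples of [d]. Hence [d] divides [z (r ^+ L.+1) * n ^ L.+1]. *)
Lemma top_coef_dvd (r : rat) (N : pred nat) n d L (z z' : fz) :
  0 < r < 1 -> n%:R = r * d%:R -> (0 < d)%N -> coprime n d ->
  kerM (expPuiseux r N) z z' ->
  (forall a, (0 < z a)%N -> r ^+ L.+1 <= a) ->
  (forall a, (0 < z' a)%N -> r ^+ L <= a) ->
  (d %| z (r ^+ L.+1))%N.
Proof.
move=> r01 nd d_gt0 cop [Fz Fz' e] ge_z ge_z'; have /andP[r_gt0 r_lt1] := r01.
set c := z _; pose w := fz_sub z (fz_single (r ^+ L.+1) c).
have ew : fz_add w (fz_single (r ^+ L.+1) c) = z.
  by apply: fz_subK => a; rewrite fz_singleE; case: eqP => [->|].
have Fw : isFact (expPuiseux r N) w by apply: isFact_sub.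
have [|A eA] := fpi_den r N n d L w r01 nd Fw.
  move=> a; rewrite fz_subE fz_singleE; case: eqP => [->|ne]; first by rewrite subnn.
  rewrite subn0 => za; have /isFactP/(_ a za) ata := Fz.
  have := ge_z a za; have [k _ ea] := atom_expPuiseux r N a r_gt0 ata; subst a.
  rewrite !ler_iXn2l // leq_eqVlt => /predU1P[ek|//].
  by case: ne; rewrite ek.
have [A' eA'] := fpi_den r N n d L z' r01 nd Fz' ge_z'.
suff /eqP : (d * A + c * n ^ L.+1)%:R = (d * A')%:R :> rat.
  rewrite eqr_nat => /eqP eq_nat; have : (d %| n ^ L.+1 * c)%N.
    by rewrite mulnC -(dvdn_addr _ (dvdn_mulr A (dvdnn d))) eq_nat dvdn_mulr.
  by rewrite Gauss_dvdr // coprime_sym coprimeXl.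
rewrite natrD !natrM -eA' -e -[in RHS]ew fpiD fpi_single !mulrDr -eA.
by rewrite natrX nd exprMn -[r ^+ _ *+ c]mulr_natl [d%:R ^+ L.+1]exprS; ring.
Qed.

Lemma modn_solve (n e x y : nat) : (0 < n)%N -> coprime e n ->
  exists i, (x + i * e = y %[mod n])%N.
Proof.
move=> n_gt0 cop; have [a _ /dvdnP[t]] := Bezoutr e n_gt0.
(* Modulo [n], [a * e] is -1 and [n.-1 * y] is [- y], so the witness times [e] is [y - x]. *)
rewrite (eqP cop) => et; exists (a * (x + n.-1 * y))%N.
apply/eqP; rewrite -(eqn_modDr (n.-1 * y)) -mulSn prednK // modnMr.
have -> : (x + a * (x + n.-1 * y) * e + n.-1 * y =
    (x + n.-1 * y) * (1 + a * e))%N by ring.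
by rewrite et mulnA modnMl.
Qed.

Lemma exponent_bound (r : rat) (N : pred nat) (s : seq rat) : 0 < r < 1 ->
  (forall a, a \in s -> atom (expPuiseux r N) a) ->
  exists L, all (fun a => r ^+ L <= a) s.
Proof.
move=> /andP[r_gt0 r_lt1]; elim: s => [|a s IHs] ats; first by exists 0%N.
have [k _ ->] := atom_expPuiseux r N a r_gt0 (ats a (mem_head _ _)).
have [|L /allP le_L] := IHs; first by move=> b bs; apply: ats; rewrite inE bs orbT.
exists (maxn k L); rewrite /= ler_iXn2l // leq_maxl; apply/allP => b /le_L.
by apply: le_trans; rewrite ler_iXn2l // leq_maxr.
Qed.

Lemma presentable_ge1 (r : rat) N : 0 < r -> numerical_monoid N ->
  atomic (expPuiseux r N) -> ACCP_presentable (expPuiseux r N) -> 1 <= r.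
Proof.
move=> r_gt0 NM atm; case: leP => // r_lt1 pres.
have [n [d [n_gt0 d_gt0 cop nd]]] := rat_ratio _ r_gt0.
have lt_nd : (n < d)%N by rewrite (lt_ratio nd).
have r01 : 0 < r < 1 by rewrite r_gt0.
have n_gt1 := atomic_num_gt1 _ _ _ _ r01 NM atm n_gt0 d_gt0 nd.
have at_exp k : N k -> atom (expPuiseux r N) (r ^+ k).
  exact: expPuiseux_atom nd.
case: NM => N0 ND [B NB].
set M := expPuiseux r N in atm pres at_exp *.
pose cnt := count_below (r ^+ B).
pose sigma z z' := kerM M z z' /\ (cnt z = cnt z' %[mod n])%N.
have sigma_ker z z' : sigma z z' -> kerM M z z' by case.
(* The case where the smallest atom [r ^+ L.+1] occurs in [z] but not in [z']. *)
have conn_top L (z z' : fz) :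
    (B < L.+1)%N -> kerM M z z' -> (0 < z (r ^+ L.+1))%N ->
    (forall a, (0 < z a)%N -> r ^+ L.+1 <= a) ->
    (forall a, (0 < z' a)%N -> r ^+ L <= a) -> Gconn M sigma z z'.
  move=> ltBL k z_gt0 ge_z ge_z'; have [Fz _ _] := k.
  have /(dvdn_leq z_gt0) le_dz := top_coef_dvd _ _ _ _ _ _ _ r01 nd d_gt0 cop k ge_z ge_z'.
  (* Each refinement of [z] adds [d - n] atoms below [r ^+ B], and [d - n] is coprime to [n], so the
     residue of [z'] is reached. *)
  have [|i ei] := modn_solve n (d - n) (cnt z) (cnt z') n_gt0.
    by rewrite coprime_sym /coprime -(gcdnDl n (d - n)) subnKC // ltnW.
  have [|y [c _ ey]] := Rchain_refine r N n d B L.+1 z i r01 nd lt_nd ltBL _ Fz le_dz.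
    by move=> j leLj; apply/at_exp/NB/(leq_trans (ltnW ltBL)).
  apply: (@gc_trans _ _ _ y); first exact: gc_class.
  apply: gc_edge; left; split; last by rewrite /cnt ey.
  exact: kerM_trans (kerM_sym _ _ _ (Rchain_kerM _ _ _ c)) k.
have conn z z' : kerM M z z' -> Gconn M sigma z z'.
  move=> k; have [Fz Fz' _] := k.
  have [/hasP[a az az']|/hasPn noshare] := boolP (has (fun a => 0 < z' a)%N (finsupp z)).
    apply/gc_class/Rchain1 => //; exists a; split=> //.
    by move: az; rewrite mem_finsupp lt0n.
  have [|L0 bL0] := exponent_bound r N (finsupp z ++ finsupp z') r01.
    by move=> a; rewrite mem_cat => /orP[/Fz|/Fz'].
  (* If positive, the minimal [L] is the largest exponent occurring in [z] or [z']. *)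
  have [L /allP bL Lmin] := ex_minnP (ex_intro
    (fun L => all (fun a => r ^+ L <= a) (finsupp z ++ finsupp z')) L0 bL0).
  have geL (y : fz) a : y = z \/ y = z' -> (0 < y a)%N -> r ^+ L <= a.
    by move=> yz ya; apply: bL; rewrite mem_cat !mem_finsupp -!lt0n;
      case: yz ya => -> ->; rewrite ?orbT.
  have [leLB|ltBL] := leqP L B.
    apply: gc_edge; left; split=> //.
    have cnt0 y : y = z \/ y = z' -> cnt y = 0%N.
      move=> yz; apply: count_below0 => a /(geL _ _ yz); apply: le_trans.
      by rewrite ler_iXn2l.
    by rewrite !cnt0 //; [right|left].
  case: L ltBL bL Lmin geL => // L ltBL bL Lmin geL.
  have /allPn[a] : ~~ all (fun a => r ^+ L <= a) (finsupp z ++ finsupp z').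
    by apply/negP => /Lmin; rewrite ltnn.
  move=> a_in; rewrite -ltNge => lt_a.
  have ata : atom M a by move: a_in; rewrite mem_cat => /orP[/Fz|/Fz'].
  have ea : a = r ^+ L.+1.
    have := bL a a_in; have [i _ ei] := atom_expPuiseux r N a r_gt0 ata.
    move: lt_a; rewrite ei ler_iXn2l // ltr_iXn2l // => ltLi leiL.
    by congr (_ ^+ _); apply/eqP; rewrite eqn_leq leiL.
  (* The factorization that avoids the smallest atom [a] has only exponents at most [L], as
     [conn_top] requires. *)
  have geL' (y : fz) b : y = z \/ y = z' -> y a = 0%N -> (0 < y b)%N -> r ^+ L <= b.
    move=> yz y0 yb; have := geL y b yz yb.
    have atb : atom M b by case: yz yb => -> ?;
      [apply: Fz|apply: Fz']; rewrite mem_finsupp -lt0n.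
    have [i _ ei] := atom_expPuiseux r N b r_gt0 atb; subst b.
    rewrite !ler_iXn2l // leq_eqVlt => /predU1P[ei|//].
    by move: yb; rewrite ei -ea y0.
  have [za|za] := posnP (z a).
    have z'a : (0 < z' a)%N.
      by move: a_in; rewrite mem_cat !mem_finsupp za eqxx /= lt0n.
    apply/Gconn_sym/(conn_top L) => //; [exact: kerM_sym|by rewrite -ea| |].
    - by move=> b; apply: geL; right.
    - by move=> b; apply: geL' => //; left.
  apply: (conn_top L) => //; first by rewrite -ea.
  - by move=> b; apply: geL; left.
  - move=> b; apply: geL'; first by right.
    apply/eqP; rewrite -leqn0 leqNgt; apply: noshare.
    by rewrite mem_finsupp -lt0n.
have [_ [|_ gen]] := pres sigma sigma_ker.
  by move=> x _ z z' Fz Fz' ez ez'; apply: conn; split; rewrite ?ez.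
have NB1 : N B by apply: NB.
have NB2 : N B.+1 by apply: NB.
(* This pair shows that [sigma] is proper: its counts are 0 and [d], so otherwise [n] would divide
   [d]. *)
have kB : kerM M (fz_single (r ^+ B) n) (fz_single (r ^+ B.+1) d).
  split; try exact/isFact_single/at_exp.
  by rewrite !fpi_single; have := expr_swap B 1 nd; rewrite !expn1 addn1 => ->.
have : sigma (fz_single (r ^+ B) n) (fz_single (r ^+ B.+1) d).
  have /gen := kB; apply: (cong_gen_min M sigma sigma) => //.
  - by move=> z z' [/kerM_sym k e]; split.
  - move=> z1 z2 z3 [k12 e12] [k23 e23]; split; last by rewrite e12.
    exact: kerM_trans k12 k23.
  - move=> z z' w Fw [k e]; split; first exact: kerM_add.
    by rewrite /cnt !count_belowD -modnDml e modnDml.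
case=> _; rewrite /cnt !count_below_single ltxx ltr_iXn2l // ltnSn mod0n => /esym/eqP.
move/gcdn_idPl => e; move: cop; rewrite /coprime e => /eqP n1.
by rewrite n1 in n_gt1.
Qed.

Theorem mainTheorem15 (r : rat) (N : pred nat) :
  0 < r -> numerical_monoid N -> atomic (expPuiseux r N) ->
  [/\ (1 <= r <-> ACCP (expPuiseux r N)),
      (ACCP (expPuiseux r N) <-> ACCP_presentable (expPuiseux r N))
    & (ACCP_presentable (expPuiseux r N) <->
       forall a, atom (expPuiseux r N) a -> omega_finite (expPuiseux r N) a)].
Proof.
move=> r_gt0 NM atm.
have accp : 1 <= r <-> ACCP (expPuiseux r N).
  by split; [exact: ACCP_expPuiseux | exact: ACCP_ge1].
have pres : 1 <= r <-> ACCP_presentable (expPuiseux r N).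
  by split; [exact: presentable_expPuiseux | exact: presentable_ge1].
have omega : 1 <= r <->
    forall a, atom (expPuiseux r N) a -> omega_finite (expPuiseux r N) a.
  split; last exact: omega_finite_ge1.
  by move=> r_ge1 a; apply: omega_finite_expPuiseux.
by split; [|rewrite -accp|rewrite -pres].
Qed.
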